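(* Let $F^\bullet$ be a bounded sequence of based finite-rank free $R_n$-modules with homogeneous basis indexed by $I$, let $(x_i)_{i\in I}\in(\mathbb{R}^n)^I$ be a choice of points, and let $\{S_i\}_{i\in I}=\{S_i(F^\bullet)\}_{i\in I}$ be the associated subsets of $\mathbb{R}^n$. The $S_i$ are uniquely characterized by the formula $$S_i=\bigcup_{j\in I}\Big(\bigcup_{m\in E_{ji}}[x_i,S_j+m]\Big),$$ where the right-hand side is understood to be $\{x_i\}$ if $E_{ji}$ is empty for all $j\in I$. In particular, the $S_i$ are contractible, compact, subanalytic subsets such that $S_j+m\subset S_i$ for all $i,j\in I$ and $m\in E_{ji}$.
   Context: $R_n:=\mathbb{C}[z_1^{\pm1},\dots,z_n^{\pm1}]$ and $z^m=z_1^{m_1}\cdots z_n^{m_n}$ for $m\in\mathbb{Z}^n$. Sequences. $F^\bullet=\cdots\to F^k\xrightarrow{d^k}F^{k+1}\to\cdots$ is a bounded sequence of finite-rank free $R_n$-modules and homomorphisms (it is not required that $d^2=0$). It is based: for each $k$ there is a fixed finite set $I_k$ and an isomorphism $F^k\cong R_n^{\oplus I_k}$. $I:=\bigsqcup_k I_k$ and $\deg:I\to\mathbb{Z}$ is $\deg(i)=k$ for $i\in I_k$. It is assumed $F^0\not\cong0$ and $F^k\cong0$ for $k>0$. For $i\in I_{k+1}$, $j\in I_k$, $d^k_{ij}\in R_n$ is the entry in row $i$, column $j$ of the matrix of $d^k$. Exponent sets $E_{ij}\subset\mathbb{Z}^n$ for $i,j\in I$: (a) if $\deg(i)\le\deg(j)$,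 $E_{ij}=\emptyset$; (b) if $\deg(i)=\deg(j)+1$, $E_{ij}$ is the set of exponents of $d^{\deg(j)}_{ij}$, i.e. $d^{\deg(j)}_{ij}=\sum_{m\in E_{ij}}c_{ijm}z^m$ with all $c_{ijm}\ne0$; (c) if $\deg(i)=\deg(j)+k$ with $k>1$, then $m\in E_{ij}$ iff $m=\sum_{\ell=1}^k m_\ell$ for some $i_1,\dots,i_{k-1}\in I$ with $\deg(i_\ell)=\deg(j)+\ell$ and some $(m_1,\dots,m_k)\in E_{i_1j}\times E_{i_2i_1}\times\cdots\times E_{i\,i_{k-1}}$. The subsets $S_i=S_i(F^\bullet)\subset\mathbb{R}^n$ are $$S_i:=\bigcup_{k\ge0}\ \bigcup_{i_1,\dots,i_k\in I}\ \bigcup_{(m_1,\dots,m_k)\in E_{i_1i}\times E_{i_2i_1}\times\cdots\times E_{i_ki_{k-1}}}\Big[x_i,\,x_{i_1}+m_1,\,\dots,\,x_{i_k}+\textstyle\sum_{\ell=1}^k m_\ell\Big],$$ where $[y_0,\dots,y_k]$ denotes the convex hull and the $k=0$ subset is $\{x_i\}$. For a point $x\in\mathbb{R}^n$ and a nonempty subset $S\subset\mathbb{R}^n$, $[x,S]:=\{tx+(1-t)y : y\in S,\ t\in[0,1]\}$, and $[x,S]:=\{x\}$ if $S$ is empty. *)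

(* Defs.v *)
From HB Require Import structures.
From mathcomp Require Import all_boot all_order all_algebra.
From mathcomp Require Import finmap.
From mathcomp Require Import complex.
From mathcomp Require Import monalg.
From mathcomp Require Import boolp classical_sets functions cardinality.
From mathcomp Require Import interval_inference reals ereal topology normedtype convex.
From mathcomp.analysis.showcase Require summability.

Set Implicit Arguments.
Unset Strict Implicit.
Unset Printing Implicit Defensive.

Import Order.TTheory GRing.Theory Num.Theory.
Import numFieldNormedType.Exports.
Local Open Scope classical_set_scope.
Local Open Scope ring_scope.

(* monalg only gives [{malg A[G]}] a product when the only invertible element
   of [G] is the unit, which excludes Z^n; hence the following instance of the
   group algebra of an abelian group, with the same convolution product. *)
Definition group_algebra (A : comNzRingType) (G : zmodType) := {malg A[G]}.

Section GroupAlgebra.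
Local Open Scope fset_scope.
Local Open Scope ring_scope.
Variables (A : comNzRingType) (G : zmodType).
Implicit Types (f g h : group_algebra A G) (k l : G).

HB.instance Definition _ := GRing.Lmodule.on (group_algebra A G).

Definition gaone : group_algebra A G := << 1 *g 0 >>.

Definition gamul f g : group_algebra A G :=
  \sum_(k <- msupp f) \sum_(l <- msupp g) << f@_k * g@_l *g k + l >>.

Lemma gamulw (d1 d2 : {fset G}) f g :
  msupp f `<=` d1 -> msupp g `<=` d2 ->
  gamul f g = \sum_(k <- d1) \sum_(l <- d2) << f@_k * g@_l *g k + l >>.
Proof.
move=> le_d1 le_d2; rewrite /gamul (big_fset_incl _ le_d1) /=.
  apply/eq_bigr=> k1 _; apply/big_fset_incl => // k _ /mcoeff_outdom ->.
  by rewrite mulr0 monalgU0.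
move=> k _ /mcoeff_outdom fk.
by rewrite big1 // => k' _; rewrite fk mul0r monalgU0.
Qed.

Lemma gamulC : commutative gamul.
Proof.
move=> f g; rewrite /gamul exchange_big; apply/eq_bigr=> k _.
by apply/eq_bigr=> l _; rewrite mulrC addrC.
Qed.

Lemma gamulUg c k g :
  gamul << c *g k >> g = \sum_(l <- msupp g) << c * g@_l *g k + l >>.
Proof.
rewrite (gamulw msuppU_le (fsubset_refl _)) big_seq_fset1.
by apply/eq_bigr => l _; rewrite mcoeffUU.
Qed.

Lemma gamulUU a b k l :
  gamul << a *g k >> << b *g l >> = << a * b *g k + l >>.
Proof. by rewrite (gamulw msuppU_le msuppU_le) !big_seq_fset1 !mcoeffUU. Qed.

Lemma gamulEl f g : gamul f g = \sum_(k <- msupp f) gamul << f@_k *g k >> g.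
Proof. by apply/eq_bigr=> k _; rewrite gamulUg. Qed.

Lemma gamul1g : left_id gaone gamul.
Proof.
move=> g; rewrite gamulUg [RHS]monalgE.
by apply/eq_bigr=> k _; rewrite mul1r add0r.
Qed.

Lemma gamul0g : left_zero 0 gamul.
Proof. by move=> g; rewrite /gamul msupp0 big_seq_fset0. Qed.

Lemma gamulDl : left_distributive gamul +%R.
Proof.
move=> f g h.
rewrite [in RHS](gamulw (fsubsetUl _ (msupp g)) (fsubset_refl _)).
rewrite [in RHS](gamulw (fsubsetUr (msupp f) _) (fsubset_refl _)).
rewrite (gamulw (msuppD_le _ _) (fsubset_refl _)).
rewrite -big_split /=; apply/eq_bigr=> k _.
rewrite -big_split /=; apply/eq_bigr=> l _.
by rewrite mcoeffD mulrDl monalgUD.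
Qed.

Lemma gamulA : associative gamul.
Proof.
have mulDr f : {morph gamul f : g h / g + h}.
  by move=> g h; rewrite gamulC gamulDl !(gamulC f).
have mul0 f : gamul f 0 = 0 by rewrite gamulC gamul0g.
have mulDl g : {morph gamul^~ g : f h / f + h} by move=> f h; exact: gamulDl.
move=> f g h.
rewrite [RHS](big_morph (gamul^~ _) (mulDl _) (gamul0g _)).
rewrite gamulEl; apply/eq_bigr=> k1 _.
rewrite [LHS](big_morph (gamul _) (mulDr _) (mul0 _)).
rewrite [RHS](big_morph (gamul^~ _) (mulDl _) (gamul0g _)).
apply/eq_bigr=> k2 _.
rewrite [LHS](big_morph (gamul _) (mulDr _) (mul0 _)).
rewrite gamulUg; apply/eq_bigr=> k3 _.
by rewrite gamulUU mulrA addrA.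
Qed.

Lemma gaone_neq0 : gaone != 0.
Proof.
by apply/eqP/malgP=> /(_ 0) /eqP; rewrite mcoeffUU mcoeff0 oner_eq0.
Qed.

HB.instance Definition _ := GRing.Zmodule_isComNzRing.Build
  (group_algebra A G) gamulA gamulC gamul1g gamulDl gaone_neq0.

End GroupAlgebra.

(* C[z_1^{+-1}, ..., z_n^{+-1}]: the monomial z^m is [<< 1 *g m >>]. *)
Notation laurent R n := (group_algebra R[i] 'rV[int]_n).

Record based_sequence (R : realType) (n : nat) := BasedSequence {
  bmod : int -> lmodType (laurent R n);
  bdiff : forall k, {linear bmod k -> bmod (k + 1)};
  bidx : int -> finType;
  bcoord : forall k, {linear bmod k -> {ffun bidx k -> (laurent R n)^o}};
  bcoord_bij : forall k, bijective (bcoord k);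
  bmod_bounded : exists N : int, forall k, k < N -> forall v : bmod k, v = 0;
  bmod0_neq0 : exists v : bmod 0, v != 0;
  bmod_gt0 : forall k, 0 < k -> forall v : bmod k, v = 0
}.

Section Sequences.
Variables (R : realType) (n : nat) (F : based_sequence R n).

Definition basis_index := {k : int & bidx F k}.

Definition deg (i : basis_index) : int := projT1 i.

(* The [b]-th element of the chosen basis of [bmod F k]. *)
Definition basis_vector k (b : bidx F k) : bmod F k :=
  xget 0 [set v | bcoord F k v = [ffun b' => (b' == b)%:R]].

Definition entry k (a : bidx F (k + 1)) (b : bidx F k) : laurent R n :=
  bcoord F (k + 1) (bdiff F k (basis_vector b)) a.

(* The exponents of the entry (i, j) when deg i = deg j + 1, and the empty set
   otherwise. *)
Definition exponents1 (i j : basis_index) : set 'rV[int]_n :=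
  [set m | exists k (a : bidx F (k + 1)) (b : bidx F k),
    [/\ i = existT _ (k + 1) a, j = existT _ k b & m \in msupp (entry a b)]].

(* Chains are encoded by functions on [nat] of which only the values
   [p 0], ..., [p k] and [q 0], ..., [q (k - 1)] matter. *)
Definition exponents (i j : basis_index) : set 'rV[int]_n :=
  [set m |
    (deg i = deg j + 1 /\ exponents1 i j m) \/
    (exists k : nat, [/\ (1 < k)%N, deg i = deg j + k%:Z &
      exists (p : nat -> basis_index) (q : nat -> 'rV[int]_n),
        [/\ p 0%N = j, p k = i,
            forall l, (l <= k)%N -> deg (p l) = deg j + l%:Z,
            forall l, (l < k)%N -> exponents1 (p l.+1) (p l) (q l)
          & m = \sum_(l < k) q l]])].

Definition realpt (m : 'rV[int]_n) : 'rV[R]_n := map_mx intr m.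

Definition translate (T : set 'rV[R]_n) (m : 'rV[int]_n) : set 'rV[R]_n :=
  [set y + realpt m | y in T].

Definition convex_hull (T : set 'rV[R]_n) : set 'rV[R]_n :=
  smallest (@convex_set R 'rV[R]_n) T.

Definition cone (x : 'rV[R]_n) (T : set 'rV[R]_n) : set 'rV[R]_n :=
  if `[< T = set0 >] then [set x] else
  [set z | exists y (t : R), [/\ T y, 0 <= t <= 1 & z = t *: x + (1 - t) *: y]].

Variable x : basis_index -> 'rV[R]_n.

Definition S_set (i : basis_index) : set 'rV[R]_n :=
  [set y | exists (k : nat) (p : nat -> basis_index) (q : nat -> 'rV[int]_n),
    [/\ p 0%N = i,
        forall l, (l < k)%N -> exponents (p l.+1) (p l) (q l)
      & convex_hull [set x (p l) + realpt (\sum_(r < l) q r) |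
                       l in [set l | (l <= k)%N]] y]].

Definition cone_formula (T : basis_index -> set 'rV[R]_n) (i : basis_index) :
    set 'rV[R]_n :=
  if `[< forall j, exponents j i = set0 >] then [set x i] else
  \bigcup_(j in [set: basis_index]) \bigcup_(m in exponents j i)
    cone (x i) (translate (T j) m).

End Sequences.

Definition contractible (T : topologicalType) (R : realType) (A : set T) :=
  exists2 a, A a & exists H : R * T -> T,
    [/\ {within `[0, 1] `*` A, continuous H},
        forall t y, 0 <= t <= 1 -> A y -> A (H (t, y)),
        forall y, A y -> H (0, y) = y
      & forall y, A y -> H (1, y) = a].

Section Subanalytic.
Variable R : realType.

(* [summability.totally] is the filter of finite sets of multi-indices, so
   that the power series converges unconditionally, i.e. absolutely. *)
Definition analytic_at (n : nat) (f : 'rV[R]_n -> R) (a : 'rV[R]_n) :=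
  exists (c : {ffun 'I_n -> nat} -> R) (r : R), 0 < r /\
    forall y, ball a r y ->
      summability.partial_sum
        (fun alpha => c alpha * \prod_(i < n) (y 0 i - a 0 i) ^+ alpha i)
        @ summability.totally --> f y.

Definition analytic_on (n : nat) (U : set 'rV[R]_n) (f : 'rV[R]_n -> R) :=
  forall a, U a -> analytic_at f a.

Definition semianalytic (n : nat) (A : set 'rV[R]_n) :=
  forall a : 'rV[R]_n, exists U : set 'rV[R]_n, [/\ open U, U a &
    exists (p q : nat) (f : 'I_p -> 'I_q -> 'rV[R]_n -> R)
        (e : 'I_p -> 'I_q -> bool),
      (forall i j, analytic_on U (f i j)) /\
      A `&` U = U `&` \bigcup_(i in [set: 'I_p]) \bigcap_(j in [set: 'I_q])
        (if e i j then [set y | f i j y = 0] else [set y | 0 < f i j y])].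

(* Subsets that are locally projections along R^n x R^p -> R^n of relatively
   compact semianalytic sets (Bierstone-Milman). *)
Definition subanalytic (n : nat) (A : set 'rV[R]_n) :=
  forall a : 'rV[R]_n, exists2 U : set 'rV[R]_n, nbhs a U &
    exists (p : nat) (B : set 'rV[R]_(n + p)),
      [/\ semianalytic B, precompact B & A `&` U = lsubmx @` B].

End Subanalytic.

(* Main.v *)
Require Import Defs.
From mathcomp Require Import all_boot all_order all_algebra.
From mathcomp Require Import boolp classical_sets reals topology normedtype.
From mathcomp Require Import finmap functions cardinality interval_inference.
From mathcomp Require Import convex lra zify.
From mathcomp Require monalg.
From mathcomp.analysis.showcase Require summability.
Import Order.TTheory GRing.Theory Num.Theory.
Import numFieldNormedType.Exports.
Local Open Scope classical_set_scope.
Local Open Scope ring_scope.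

(* The convex hull of a point x and a nonempty set T is the cone over the hull
   of T with apex x; splitting off the first vertex of a chain therefore yields
   the cone formula.  Every exponent m in E_ji has deg j > deg i, and degrees
   lie in a finite range, so a statement about all solutions of the cone formula
   can be proved by induction on |deg i|: this gives uniqueness, and shows that
   S_i is built from points by finitely many translations, cones and finite
   unions.  These operations preserve compactness and the class of finite unions
   of simplices.  Finally S_i is star-shaped about x_i. *)

(** * Convex hulls, cones and integer translations *)

Section ConvexHull.
Variables (R : realType) (n : nat).
Implicit Types (x y z : 'rV[R]_n) (A T : set 'rV[R]_n) (m : 'rV[int]_n).

Lemma scale_onem_id (t : R) x : t *: x + (1 - t) *: x = x.
Proof. by rewrite -scalerDl addrC subrK scale1r. Qed.

Lemma convex_setP A :
  @convex_set R 'rV[R]_n A <->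
  forall y z (t : R), A y -> A z -> 0 <= t <= 1 -> A (t *: y + (1 - t) *: z).
Proof.
split=> [cA y z t Ay Az /andP[t0 t1]|cA y z t /set_mem Ay /set_mem Az].
  have /set_mem := cA y z (Itv01 t0 t1) (mem_set Ay) (mem_set Az).
  exact.
by apply: mem_set; apply: cA => //; apply/andP; split; [exact: ge0|exact: le1].
Qed.

Lemma convex_hull_convex A y z (t : R) :
  convex_hull A y -> convex_hull A z -> 0 <= t <= 1 ->
  convex_hull A (t *: y + (1 - t) *: z).
Proof.
move=> Ay Az t01 B [cB AB]; move/convex_setP: (cB); apply => //.
- exact: Ay.
- exact: Az.
Qed.

Lemma sub_convex_hull A : A `<=` convex_hull A.
Proof. exact: sub_gen_smallest. Qed.

Lemma convex_hull_min A T :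
  (forall y z (t : R), T y -> T z -> 0 <= t <= 1 -> T (t *: y + (1 - t) *: z)) ->
  A `<=` T -> convex_hull A `<=` T.
Proof. by move=> cT AT; apply: smallest_sub => //; apply/convex_setP. Qed.

Lemma convex_hull1 x : convex_hull [set x] = [set x].
Proof.
apply/seteqP; split; last exact: sub_convex_hull.
apply: convex_hull_min => // _ _ t -> -> _.
by rewrite /= scale_onem_id.
Qed.

Lemma coneE x T : T !=set0 ->
  cone x T =
  [set z | exists y (t : R), [/\ T y, 0 <= t <= 1 & z = t *: x + (1 - t) *: y]].
Proof. by case=> y Ty; rewrite /cone asboolF // => T0; rewrite T0 in Ty. Qed.

Lemma cone_apex x T : cone x T x.
Proof.
have [->|/set0P T0] := eqVneq T set0; first by rewrite /cone asboolT.
case: (T0) => y Ty; rewrite coneE //; exists y, 1.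
by rewrite ler01 lexx subrr scale0r scale1r addr0.
Qed.

Lemma sub_cone x T : T `<=` cone x T.
Proof.
move=> y Ty; rewrite coneE; last by exists y.
by exists y, 0; rewrite ler01 lexx subr0 scale0r scale1r add0r.
Qed.

Lemma cone_star x T z (t : R) : cone x T z -> 0 <= t <= 1 ->
  cone x T (t *: x + (1 - t) *: z).
Proof.
have [->|/set0P T0] := eqVneq T set0.
  rewrite /cone asboolT //= => -> _.
  by rewrite scale_onem_id.
rewrite coneE // => -[y [s [Ty s01 ->]]] t01.
exists y, (t + (1 - t) * s); split=> //; first by nra.
rewrite scalerDr !scalerA addrA -scalerDl; congr (_ + _ *: _).
by rewrite opprD mulrBr mulr1 addrA.
Qed.

(** The combination puts total weight [a = l * (1 - s) + (1 - l) * (1 - t)] on [T]. Dividing by [a]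
    gives a convex combination of [y] and [z], and the remaining weight [1 - a] falls on the
    apex. *)
Lemma cone_convex x T :
  (forall y z (t : R), T y -> T z -> 0 <= t <= 1 -> T (t *: y + (1 - t) *: z)) ->
  forall y z (t : R), cone x T y -> cone x T z -> 0 <= t <= 1 ->
    cone x T (t *: y + (1 - t) *: z).
Proof.
have [->|/set0P T0] := eqVneq T set0.
  rewrite /cone asboolT //= => _ y z t -> -> _.
  by rewrite scale_onem_id.
rewrite coneE // => cT _ _ l [y [s [Ty s01 ->]]] [z [t [Tz t01 ->]]] l01.
have [/andP[s0 s1] /andP[t0 t1] /andP[l0 l1]] := And3 s01 t01 l01.
have u0 : 0 <= l * (1 - s) by rewrite mulr_ge0 // subr_ge0.
have v0 : 0 <= (1 - l) * (1 - t) by rewrite mulr_ge0 // subr_ge0.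
(* If no weight falls on [T], the combination is [x] itself and any base point, here [y], serves
   with coefficient 1. *)
have [a0|a0] := eqVneq (l * (1 - s) + (1 - l) * (1 - t)) 0.
  exists y, 1; split => //; first by rewrite ler01 lexx.
  have [e1 e2] : l * (1 - s) = 0 /\ (1 - l) * (1 - t) = 0 by split; lra.
  rewrite !scalerDr !scalerA e1 e2 subrr !scale0r !addr0 -scalerDl.
  by congr (_ *: _); lra.
set a := _ + _ in a0.
have agt0 : 0 < a by rewrite lt_neqAle eq_sym a0 addr_ge0.
have a1 : a <= 1.
  have ls0 : 0 <= l * s by rewrite mulr_ge0.
  have lt0 : 0 <= (1 - l) * t by rewrite mulr_ge0 // subr_ge0.
  by rewrite /a; lra.
exists ((l * (1 - s) / a) *: y + (1 - l * (1 - s) / a) *: z), (1 - a).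
split; first apply: cT => //.
- by rewrite divr_ge0 ?(ltW agt0) // ler_pdivrMr // mul1r /a lerDl.
- by lra.
rewrite subKr !scalerDr !scalerA.
have aK : a * (l * (1 - s) / a) = l * (1 - s) by rewrite mulrC divfK.
rewrite (mulrBr a) (mulr1 a) aK addrACA -scalerDl.
by congr (_ *: _ + (_ *: _ + _ *: _)); rewrite /a; lra.
Qed.

(** The cone is convex and contains all generators; conversely, the hull is convex and contains both
    [x] and the hull of [T], hence all segments between them. *)
Lemma convex_hull_setU1 x T : T !=set0 ->
  convex_hull (x |` T) = cone x (convex_hull T).
Proof.
move=> T0; have H0 : convex_hull T !=set0.
  by case: T0 => y /sub_convex_hull; exists y.
apply/seteqP; split.
  apply: convex_hull_min.
    by apply: cone_convex; exact: convex_hull_convex.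
  move=> y [->|/sub_convex_hull /sub_cone]; last exact.
  exact: cone_apex.
rewrite coneE // => _ [y [t [Hy t01 ->]]].
apply: convex_hull_convex => //; first by apply: sub_convex_hull; left.
move: y Hy; apply: convex_hull_min; first exact: convex_hull_convex.
by move=> y Ty; apply: sub_convex_hull; right.
Qed.

Lemma convex_hull_translate T m :
  convex_hull (translate T m) = translate (convex_hull T) m.
Proof.
have comb y z (t : R) (v : 'rV[R]_n) :
    t *: (y + v) + (1 - t) *: (z + v) = t *: y + (1 - t) *: z + v.
  by rewrite !scalerDr addrACA scale_onem_id.
apply/seteqP; split.
  apply: convex_hull_min => [_ _ t [y Hy <-] [z Hz <-] t01|_ [y Ty <-]].
    rewrite comb; exists (t *: y + (1 - t) *: z) => //.
    exact: convex_hull_convex.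
  by exists y => //; exact: sub_convex_hull.
move=> _ [y Hy <-].
(* The preimage of a convex set under a translation is convex, so minimality of the hull of [T]
   applies to it. *)
suff: convex_hull T `<=` [set y | convex_hull (translate T m) (y + realpt R m)].
  exact.
apply: convex_hull_min => [{Hy}y z t /= Hy Hz t01|{Hy}y Ty].
  by rewrite -comb; exact: convex_hull_convex.
by apply: sub_convex_hull; exists y.
Qed.

Lemma realpt0 : realpt R (0 : 'rV[int]_n) = 0.
Proof. by apply/rowP=> i; rewrite !mxE. Qed.

Lemma realptD m1 m2 : realpt R (m1 + m2) = realpt R m1 + realpt R m2.
Proof. by apply/rowP=> i; rewrite !mxE intrD. Qed.

End ConvexHull.

(** * Chains, the cone formula, and induction on the degree *)

Section ConeFormula.
Variables (R : realType) (n : nat) (F : based_sequence R n).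
Variable x : basis_index F -> 'rV[R]_n.
Implicit Types (i j : basis_index F) (m : 'rV[int]_n).

Definition chain_vertices (k : nat) (p : nat -> basis_index F)
    (q : nat -> 'rV[int]_n) : set 'rV[R]_n :=
  [set x (p l) + realpt R (\sum_(r < l) q r) | l in [set l | (l <= k)%N]].

Lemma chain_vertices_n0 k p q : chain_vertices k p q !=set0.
Proof. by eexists; exists 0%N. Qed.

Lemma chain_vertices0 p q : chain_vertices 0 p q = [set x (p 0%N)].
Proof.
have e0 : x (p 0%N) + realpt R (\sum_(r < 0) q r) = x (p 0%N).
  by rewrite big_ord0 realpt0 addr0.
apply/seteqP; split=> [_ [l /= + <-]|_ ->]; last by exists 0%N.
by rewrite leqn0 => /eqP ->; rewrite e0.
Qed.

(** Every nonempty partial sum contains [q 0], so the vertices after the first are those of the tail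
    chain translated by [q 0]. *)
Lemma chain_verticesS k p q :
  chain_vertices k.+1 p q =
  x (p 0%N) |`
    translate (chain_vertices k (fun l => p l.+1) (fun l => q l.+1)) (q 0%N).
Proof.
have e l : x (p l.+1) + realpt R (\sum_(r < l.+1) q r) =
    x (p l.+1) + realpt R (\sum_(r < l) q r.+1) + realpt R (q 0%N).
  by rewrite big_ord_recl realptD addrCA addrC.
have e0 : x (p 0%N) + realpt R (\sum_(r < 0) q r) = x (p 0%N).
  by rewrite big_ord0 realpt0 addr0.
apply/seteqP; split=> [_ [[|l] /= lk <-]|_ [->|[_ [l /= lk <-] <-]]].
- by left; rewrite e0.
- by right; rewrite e; eexists; [exists l|].
- by exists 0%N.
- by exists l.+1 => //; rewrite e.
Qed.

Lemma apex_in_S_set i : S_set x i (x i).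
Proof.
exists 0%N, (fun=> i), (fun=> 0); split=> //.
suff: convex_hull (chain_vertices 0 (fun=> i) (fun=> 0)) (x i) by [].
by rewrite chain_vertices0; exact: sub_convex_hull.
Qed.

(** A chain of length 0 contributes the apex; a longer one contributes the cone over the translated
    hull of its tail, which is again a chain. Keeping the apex as a separate member avoids the case
    distinction in [cone_formula]. *)
Lemma S_setE i : S_set x i =
  x i |` \bigcup_(j in [set: basis_index F]) \bigcup_(m in exponents j i)
    cone (x i) (translate (S_set x j) m).
Proof.
have tr0 j m : translate (S_set x j) m !=set0.
  by eexists; exists (x j) => //; exact: apex_in_S_set.
have cE k p q : p 0%N = i ->
    convex_hull (chain_vertices k.+1 p q) =
    cone (x i) (translate (convex_hull
      (chain_vertices k (fun l => p l.+1) (fun l => q l.+1))) (q 0%N)).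
  move=> pi; rewrite chain_verticesS convex_hull_setU1; last first.
    by have [y] := chain_vertices_n0 k (fun l => p l.+1) (fun l => q l.+1);
      eexists; exists y.
  by rewrite convex_hull_translate pi.
have hull0 k p q : convex_hull (chain_vertices k p q) !=set0.
  by have [y] := chain_vertices_n0 k p q; exists y; exact: sub_convex_hull.
apply/seteqP; split=> [y [[|k] [p [q [p0 E]]]]|y [->|[j _ [m Em]]]].
- rewrite -/(chain_vertices 0 p q) chain_vertices0 convex_hull1 => ->.
  by left; rewrite p0.
- rewrite -/(chain_vertices k.+1 p q) cE // coneE; last first.
    have [z Hz] := hull0 k (fun l => p l.+1) (fun l => q l.+1).
    by eexists; exists z.
  case=> _ [t [[z Hz <-] t01 ->]]; right; exists (p 1%N) => //.
  exists (q 0%N); first by have := E 0%N isT; rewrite p0.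
  rewrite coneE //; exists (z + realpt R (q 0%N)), t; split=> //.
  exists z => //; exists k, (fun l => p l.+1), (fun l => q l.+1).
  by split=> // l lk; exact: E.
- exact: apex_in_S_set.
rewrite coneE // => -[_ [t [[z [k [p [q [p0 E Hz]]]] <-] t01 ->]]].
(* The chain of [z] is prolonged at the front by the index [i] and the exponent [m]. *)
exists k.+1, (fun l => if l is l'.+1 then p l' else i),
  (fun l => if l is l'.+1 then q l' else m); split=> //.
  by move=> [|l] lk; [rewrite p0|exact: E].
rewrite -/(chain_vertices k.+1 (fun l => if l is l'.+1 then p l' else i)
  (fun l => if l is l'.+1 then q l' else m)) cE //.
have [w Hw] := hull0 k p q.
rewrite coneE; last by eexists; exists w.
by exists (z + realpt R m), t; split=> //; exists z.
Qed.

Lemma S_set_cone_formula i : S_set x i = cone_formula x (S_set x) i.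
Proof.
rewrite S_setE /cone_formula; case: asboolP => [E0|/existsNP[j /eqP/set0P[m Em]]].
  by rewrite bigcup0 ?setU0 // => j _; rewrite E0 bigcup_set0.
by apply/setUidr => _ ->; exists j => //; exists m => //; exact: cone_apex.
Qed.

Lemma translate_S_set i j m : exponents j i m ->
  translate (S_set x j) m `<=` S_set x i.
Proof.
move=> Em; rewrite [S_set x i]S_setE => y Sy; right; exists j => //.
by exists m => //; exact: sub_cone.
Qed.

Lemma S_set_star i y (t : R) : S_set x i y -> 0 <= t <= 1 ->
  S_set x i (t *: x i + (1 - t) *: y).
Proof.
rewrite S_setE => -[->|[j _ [m Em Cy]]] t01.
  by left; rewrite scale_onem_id.
by right; exists j => //; exists m => //; exact: cone_star.
Qed.

(** Degrees of indices are nonpositive, so this is [- deg i], a measure that decreases along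
    exponents. *)
Definition absdeg i : nat := absz (deg i).

(** Transfers the degree bounds, which are stated as vanishing of modules, to basis indices. *)
Lemma bmod_index_neq0 i : exists v : bmod F (deg i), v <> 0.
Proof.
case: i => k b; have [g _ Kg] := bcoord_bij F k.
exists (g [ffun=> 1]) => /(congr1 (bcoord F k)).
rewrite Kg linear0 => /ffunP/(_ b); rewrite !ffunE => /eqP.
by rewrite oner_eq0.
Qed.

Lemma deg_le0 i : deg i <= 0.
Proof.
have [v v0] := bmod_index_neq0 i.
by rewrite leNgt; apply/negP=> /bmod_gt0 /(_ v).
Qed.

Lemma deg_bounded : exists N : nat, forall i, (absdeg i <= N)%N.
Proof.
have [N HN] := bmod_bounded F; exists (absz N) => i.
have [v v0] := bmod_index_neq0 i; have := deg_le0 i.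
suff : N <= deg i by rewrite /absdeg; lia.
by rewrite leNgt; apply/negP=> /HN /(_ v).
Qed.

Lemma exponents_absdeg i j m : exponents j i m -> (absdeg j < absdeg i)%N.
Proof.
have := deg_le0 i; have := deg_le0 j; rewrite /absdeg => dj di.
by case=> [[e _]|[k [k1 e _]]]; lia.
Qed.

Lemma cone_formula_unique (T U : basis_index F -> set 'rV[R]_n) :
  (forall i, T i = cone_formula x T i) ->
  (forall i, U i = cone_formula x U i) -> forall i, T i = U i.
Proof.
move=> fT fU i; have [d] := ubnP (absdeg i).
(* The emptiness test does not involve the family of sets, so both formulas take the same branch. *)
elim: d i => // d IH i id; rewrite fT fU /cone_formula; case: asbool => //.
apply: eq_bigcupr => j _; apply: eq_bigcupr => m /exponents_absdeg ji.
by rewrite IH //; lia.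
Qed.

Lemma finite_basis_index : finite_set [set: basis_index F].
Proof.
have [N HN] := deg_bounded.
suff -> : [set: basis_index F] = \bigcup_(k in `I_N.+1)
    range (fun b : bidx F (- k%:Z) => existT (fun k => bidx F k) (- k%:Z) b).
  apply: bigcup_finite => [|k _]; first exact: finite_II.
  exact/finite_image/finite_finset.
apply/seteqP; split=> // -[k b] _; exists (absdeg (existT _ k b)).
  by rewrite /= ltnS HN.
have := deg_le0 (existT _ k b); rewrite /absdeg /deg /= => k0.
have -> : - (`|k|%N)%:Z = k by lia.
by exists b.
Qed.

Lemma finite_exponents1 : finite_set
  (\bigcup_(ij in [set: basis_index F * basis_index F])
     exponents1 ij.1 ij.2).
Proof.
apply: bigcup_finite.
  by rewrite -setXTT; apply: finite_setX; exact: finite_basis_index.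
(* Second components can be equated because equality of degrees is decidable. *)
have tagged_inj k (a b : bidx F k) :
    existT (fun k => bidx F k) k a = existT (fun k => bidx F k) k b -> a = b.
  move/eqP; rewrite (@eq_Tagged _ _ (existT (fun k => bidx F k) k a)).
  by move/eqP.
move=> [[k a] [l b]] _ /=.
have [e|kl] := eqVneq k (l + 1); last first.
  apply: (sub_finite_set (B := set0)) => // m [k' [a' [b' [e e']]]].
  move/(congr1 (@projT1 _ _)): e => /= e; move/(congr1 (@projT1 _ _)): e' => /= e'.
  by move: kl; rewrite e e' eqxx.
subst k; apply: (sub_finite_set (B := [set` monalg.msupp (entry a b)])).
  move=> m [k [a' [b' [e e' mE]]]] /=.
  have ek : l = k := congr1 (@projT1 _ _) e'.
  subst l.
  by rewrite (tagged_inj _ _ _ e) (tagged_inj _ _ _ e').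
exact: finite_fset.
Qed.

(** The number of summands of an exponent is fixed by the two degrees, and each summand comes from
    the finite set [M] of all matrix exponents. The sets [sums] forget the chain, which only
    enlarges them. *)
Lemma finite_exponents i j : finite_set (exponents j i).
Proof.
pose M := \bigcup_(ij in [set: basis_index F * basis_index F])
  exponents1 ij.1 ij.2.
pose sums k := [set m | exists2 q : nat -> 'rV[int]_n,
  forall l, (l < k)%N -> M (q l) & m = \sum_(l < k) q l].
have finM : finite_set M by exact: finite_exponents1.
have fin_sums k : finite_set (sums k).
  elim: k => [|k IH].
    apply: (sub_finite_set (B := [set 0])) => // m [q _ ->].
    by rewrite big_ord0.
  apply: sub_finite_set (finite_image2 +%R IH finM) => _ [q Mq ->].
  rewrite big_ord_recr /=; exists (\sum_(l < k) q l).
    by exists q => // l lk; apply: Mq; lia.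
  by exists (q k) => //; exact: Mq.
apply: (sub_finite_set (B := M `|` sums (absz (deg j - deg i)))).
  move=> m [[_ E]|[k [k1 dk [p [q [_ _ _ E ->]]]]]]; first by left; exists (j, i).
  right; have -> : absz (deg j - deg i) = k by lia.
  by exists q => // l lk; exists (p l.+1, p l) => //; exact: E.
by rewrite finite_setU; split.
Qed.

(** The index of [P] bounds the depth of nested cones. Points satisfy [P] at every index, so all
    [S_set x i] reach one common index, a bound on [absdeg]. *)
Lemma S_set_ind (P : nat -> set 'rV[R]_n -> Prop) :
  (forall d y, P d [set y]) ->
  (forall d y A (m : 'rV[int]_n), A !=set0 -> P d A ->
     P d.+1 (cone y (translate A m))) ->
  (forall d (I : choiceType) (D : set I) (A : I -> set 'rV[R]_n), finite_set D ->
     (forall k, D k -> P d (A k)) -> P d (\bigcup_(k in D) A k)) ->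
  exists d, forall i, P d (S_set x i).
Proof.
move=> P1 Pcone Pcup; have [N HN] := deg_bounded; exists N => i.
elim: N i {HN}(HN i) => [|d IH] i id; rewrite S_set_cone_formula /cone_formula;
  case: asboolP => [_|/existsNP[j /eqP/set0P[m Em]]] //.
  (* At bound 0 no exponent leaves [i], so only the single point occurs. *)
  by have := exponents_absdeg _ _ _ Em; lia.
rewrite (_ : \bigcup_(j in _) _ =
    \bigcup_(jm in [set jm | exponents jm.1 i jm.2])
      cone (x i) (translate (S_set x jm.1) jm.2)); last first.
  apply/seteqP; split=> [y [k _ [l Ekl Cy]]|y [[k l] /= Ekl Cy]].
    by exists (k, l).
  by exists k => //; exists l.
apply: Pcup => [|[k l] /= Ekl].
  apply: (sub_finite_set (B := \bigcup_(j in [set: basis_index F])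
      (pair j) @` exponents j i)) => [[k l] /= Ekl|].
    by exists k => //; exists l.
  apply: bigcup_finite => [|k _]; first exact: finite_basis_index.
  exact/finite_image/finite_exponents.
apply: Pcone; first by exists (x k); exact: apex_in_S_set.
by apply: IH; have := exponents_absdeg _ _ _ Ekl; lia.
Qed.

End ConeFormula.

(** * Compactness of cones and contractibility of star-shaped sets *)

Section Topology.
Variables (R : realType) (n : nat).

Lemma bigcup_compact (T : topologicalType) (I : choiceType) (D : set I)
    (A : I -> set T) :
  finite_set D -> (forall i, D i -> compact (A i)) ->
  compact (\bigcup_(i in D) A i).
Proof.
move=> /finite_seqP[s ->] cA; rewrite bigcup_seq big_seq.
exact: bigsetU_compact.
Qed.

Lemma affine_homotopy_continuous (a : 'rV[R]_n) :
  continuous (fun ty : R * 'rV[R]_n => ty.1 *: a + (1 - ty.1) *: ty.2).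
Proof.
move=> ty; have onem : 1 - uy.1 @[uy --> ty] --> (1 - ty.1 : R^o).
  by apply: cvgB; [exact: cvg_cst|exact: cvg_fst].
by apply: cvgD; apply: cvgZ; [exact: cvg_fst|exact: cvg_cst| |exact: cvg_snd].
Qed.

Lemma translate_compact (A : set 'rV[R]_n) (m : 'rV[int]_n) :
  compact A -> compact (translate A m).
Proof.
apply: continuous_compact; apply: continuous_subspaceT => y.
by apply: (@cvgD _ _ _ (nbhs y) _ id); [exact: cvg_id|exact: cvg_cst].
Qed.

(** Unless it is a single point, the cone is the image of the compact set [[0, 1] * A] under the
    affine homotopy. *)
Lemma cone_compact (a : 'rV[R]_n) (A : set 'rV[R]_n) :
  compact A -> compact (cone a A).
Proof.
move=> cA; rewrite /cone; case: asboolP => _; first exact: compact_set1.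
rewrite (_ : mkset _ = (fun ty : R * 'rV[R]_n => ty.1 *: a + (1 - ty.1) *: ty.2)
    @` (`[0, 1] `*` A)).
  apply: continuous_compact; last by apply: compact_setX => //; exact: segment_compact.
  by apply: continuous_subspaceT; exact: affine_homotopy_continuous.
apply/seteqP; split=> [z [y [t [Ay t01 ->]]]|_ [[t y] [/= + Ay] <-]].
  by exists (t, y) => //; split; rewrite //= in_itv.
by rewrite in_itv /= => t01; exists y, t.
Qed.

Lemma star_contractible (a : 'rV[R]_n) (A : set 'rV[R]_n) : A a ->
  (forall y (t : R), A y -> 0 <= t <= 1 -> A (t *: a + (1 - t) *: y)) ->
  contractible R A.
Proof.
move=> Aa starA; exists a => //.
exists (fun ty => ty.1 *: a + (1 - ty.1) *: ty.2); split=> /=.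
- by apply: continuous_subspaceT; exact: affine_homotopy_continuous.
- by move=> t y t01 Ay; exact: starA.
- by move=> y _; rewrite scale0r add0r subr0 scale1r.
- by move=> y _; rewrite subrr scale0r scale1r addr0.
Qed.

End Topology.

(** * Analyticity of the quadratic polynomials used below *)

Section Analytic.
Variables (R : realType) (n : nat).
Implicit Types (f g : 'rV[R]_n -> R) (a : 'rV[R]_n).

#[local] Existing Instance summability.totally_filter.

(** The series has at most one nonzero coefficient, so its partial sums are constant once the finite
    set contains [alpha]. *)
Lemma analytic_at_monomial (k : R) (alpha : {ffun 'I_n -> nat}) a :
  analytic_at (fun y => k * \prod_(i < n) (y 0 i - a 0 i) ^+ alpha i) a.
Proof.
exists (fun beta => if beta == alpha then k else 0), 1; split=> // y _.
apply: cvg_near_cst; exists [fset alpha]%fset => // B AB.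
have aB : alpha \in B by rewrite -fsub1set.
rewrite /summability.partial_sum.
rewrite -(big_seq_fsetE _ _ predT (fun beta => (if beta == alpha then k else 0) *
  \prod_(i < n) (y 0 i - a 0 i) ^+ beta i)) /=.
rewrite (big_fsetD1 alpha) //= eqxx [X in _ + X]big_seq [X in _ + X]big1 ?addr0 // => beta.
by rewrite !inE => /andP[/negPf -> _]; rewrite mul0r.
Qed.

Lemma analytic_at_add f g a :
  analytic_at f a -> analytic_at g a -> analytic_at (fun y => f y + g y) a.
Proof.
move=> [c [r [r0 Hf]]] [d [s [s0 Hg]]].
exists (fun alpha => c alpha + d alpha), (Num.min r s).
split=> [|y ays]; first by rewrite lt_min r0.
have yr : ball a r y by apply: le_ball ays; rewrite ge_min lexx.
have ys : ball a s y by apply: le_ball ays; rewrite ge_min lexx orbT.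
pose mono alpha := \prod_(i < n) (y 0 i - a 0 i) ^+ alpha i.
rewrite (_ : summability.partial_sum _ =
    summability.partial_sum (fun alpha => c alpha * mono alpha) \+
    summability.partial_sum (fun alpha => d alpha * mono alpha)).
  by apply: cvgD; [exact: Hf|exact: Hg].
apply/funext => B; rewrite /summability.partial_sum /= -big_split /=.
by apply: eq_bigr => alpha _; rewrite mulrDl.
Qed.

Lemma analytic_at_cst (k : R) a : analytic_at (fun=> k) a.
Proof.
have := analytic_at_monomial k [ffun=> 0%N] a; congr analytic_at.
by apply/funext => y; rewrite big1 ?mulr1 // => i _; rewrite ffunE expr0.
Qed.

Lemma analytic_at_sum (I : finType) (f : I -> 'rV[R]_n -> R) a :
  (forall i, analytic_at (f i) a) -> analytic_at (fun y => \sum_i f i y) a.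
Proof.
move=> Hf; elim: (index_enum I) => [|i s IH].
  have := analytic_at_cst 0 a; congr analytic_at.
  by apply/funext => y; rewrite big_nil.
have := analytic_at_add _ _ _ (Hf i) IH; congr analytic_at.
by apply/funext => y; rewrite big_cons.
Qed.

Lemma analytic_at_coord_shift (k : R) (i : 'I_n) (e : nat) a :
  analytic_at (fun y => k * (y 0 i - a 0 i) ^+ e) a.
Proof.
have := analytic_at_monomial k [ffun j => if j == i then e else 0%N] a.
congr analytic_at; apply/funext => y; rewrite (bigD1 i) //= ffunE eqxx.
by rewrite big1 ?mulr1 // => j ji; rewrite ffunE (negPf ji) expr0.
Qed.

Lemma analytic_at_coord (i : 'I_n) a : analytic_at (fun y => y 0 i) a.
Proof.
have := analytic_at_add _ _ _ (analytic_at_cst (a 0 i) a)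
  (analytic_at_coord_shift 1 i 1 a).
by congr analytic_at; apply/funext => y; rewrite expr1 mul1r addrC subrK.
Qed.

(** Taylor expansion of the square at [a], in powers of [y 0 i - a 0 i]. *)
Lemma analytic_at_coord_sq (k : R) (i : 'I_n) a :
  analytic_at (fun y => k * y 0 i ^+ 2) a.
Proof.
have := analytic_at_add _ _ _ (analytic_at_cst (k * a 0 i ^+ 2) a)
  (analytic_at_add _ _ _ (analytic_at_coord_shift (k * a 0 i *+ 2) i 1 a)
     (analytic_at_coord_shift k i 2 a)).
by congr analytic_at; apply/funext => y; lra.
Qed.

End Analytic.

(** * Finite unions of simplices and their subanalyticity *)

Section Polytopal.
Variables (R : realType) (n : nat).
Implicit Types (A : set 'rV[R]_n).

(** The rows of [V] are the vertices; they may repeat or be affinely dependent. *)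
Definition simplex {p : nat} (V : 'M[R]_(p, n)) : set 'rV[R]_n :=
  [set y | exists w : 'rV[R]_p,
    [/\ forall l, 0 <= w 0 l, \sum_l w 0 l = 1 & y = w *m V]].

(** A common vertex count [d.+1] lets one weight vector serve all simplices; degenerate simplices
    make smaller ones fit. *)
Definition polytopal (d : nat) A :=
  exists D : set 'M[R]_(d.+1, n),
    finite_set D /\ A = \bigcup_(V in D) simplex V.

Lemma polytopal1 d y : polytopal d [set y].
Proof.
exists [set const_mx 1 *m y]; split=> //; rewrite bigcup_set1.
have wy (w : 'rV[R]_d.+1) : \sum_l w 0 l = 1 -> w *m (const_mx 1 *m y) = y.
  move=> w1; rewrite mulmxA (_ : w *m const_mx 1 = 1%:M) ?mul1mx //.
  apply/rowP=> i; rewrite !ord1 !mxE eqxx.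
  transitivity (\sum_l w 0 l); last by rewrite w1.
  by apply: eq_bigr => l _; rewrite mxE mulr1.
apply/seteqP; split=> [_ ->|_ [w [_ w1 ->]]]; last exact: wy.
have d1 : \sum_l (delta_mx 0 0 : 'rV[R]_d.+1) 0 l = 1.
  rewrite (bigD1 0) //= mxE eqxx big1 ?addr0 // => l l0.
  by rewrite mxE (negPf l0) andbF.
exists (delta_mx 0 0); split=> //; last by rewrite wy.
by move=> l; rewrite mxE ler0n.
Qed.

(** A cone over a simplex is a simplex with one more vertex: [phi] puts the apex in the first row
    above the translated vertices. *)
Lemma polytopal_cone d y A (m : 'rV[int]_n) : A !=set0 -> polytopal d A ->
  polytopal d.+1 (cone y (translate A m)).
Proof.
move=> [u0 Au0] [D [finD defA]].
pose phi (V : 'M[R]_(d.+1, n)) : 'M[R]_(d.+2, n) :=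
  col_mx y (V + const_mx 1 *m realpt R m).
have phiE (t : R) (w : 'rV[R]_d.+1) V :
    (row_mx t%:M w : 'rV[R]_d.+2) *m phi V =
    t *: y + (w *m V + (\sum_l w 0 l) *: realpt R m).
  rewrite /phi (mul_row_col (t%:M) w y) mul_scalar_mx mulmxDr mulmxA.
  congr (_ + (_ + _)); rewrite -mul_scalar_mx; congr (_ *m _).
  apply/rowP=> i; rewrite !ord1 !mxE eqxx mulr1n.
  by apply: eq_bigr => l _; rewrite mxE mulr1.
have sumE (t : R) (w : 'rV[R]_d.+1) :
    \sum_l (row_mx t%:M w : 'rV[R]_d.+2) 0 l = t + \sum_l w 0 l.
  rewrite (@big_split_ord _ _ _ 1) big_ord1; congr (_ + _).
    by apply: etrans (row_mxEl _ _ _ _) _; rewrite mxE eqxx.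
  by apply: eq_bigr => l _; exact: (row_mxEr (t%:M : 'M_1)).
exists (phi @` D); split; first exact: finite_image.
rewrite coneE; last by eexists; exists u0.
apply/seteqP; split=> [_ [_ [t [[u Au <-] /andP[t0 t1] ->]]]|z].
  move: Au; rewrite defA => -[V DV [w [w0 w1 ->]]].
  exists (phi V); first by exists V.
  exists (row_mx t%:M ((1 - t) *: w)); split.
  - move=> l; rewrite mxE; case: splitP => i _; first by rewrite !ord1 mxE eqxx.
    by rewrite mxE mulr_ge0 // subr_ge0.
  - rewrite sumE; under eq_bigr do rewrite mxE.
    by rewrite -mulr_sumr w1 mulr1 addrC subrK.
  - rewrite phiE; under eq_bigr do rewrite mxE.
    by rewrite -mulr_sumr w1 mulr1 -scalemxAl -scalerDr.
move=> [_ [V DV <-] [w' [w0 w1 ->]]].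
pose t := lsubmx (w' : 'rV[R]_(1 + d.+1)) 0 0.
pose w := rsubmx (w' : 'rV[R]_(1 + d.+1)).
have wE : w' = row_mx t%:M w.
  rewrite -[LHS](@hsubmxK _ 1 1 d.+1) (mx11_scalar (lsubmx _)) //.
have t0 : 0 <= t by rewrite /t mxE.
have wl0 l : 0 <= w 0 l by rewrite /w mxE.
move: w1; rewrite wE sumE => w1.
have sw0 : 0 <= \sum_l w 0 l by exact: sumr_ge0.
rewrite phiE.
(* With all weight on the apex the point is [y], and [u0] supplies a base point; otherwise the
   weights [w] are normalized by their sum [1 - t]. *)
have [st|st] := eqVneq (\sum_l w 0 l) 0.
  rewrite st; have -> : w = 0.
    apply/rowP=> l; rewrite [RHS]mxE; apply/eqP; move/eqP: st.
    by rewrite psumr_eq0 // => /allP/(_ l (mem_index_enum _)).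
  exists (u0 + realpt R m), 1; split; [by exists u0|by rewrite ler01 lexx|].
  have -> : t = 1 by lra.
  by rewrite mul0mx !(subrr, scale0r) !addr0.
have e : 1 - t = \sum_l w 0 l by lra.
exists (((1 - t)^-1 *: w) *m V + realpt R m), t; split; last first.
- rewrite e scalerDr -scalemxAl scalerA divff // scale1r //.
- by apply/andP; split; lra.
- exists (((1 - t)^-1 *: w) *m V) => //; rewrite defA; exists V => //.
  eexists; split; [| |by []].
    by move=> l; rewrite mxE e mulr_ge0 // invr_ge0.
  by under eq_bigr do rewrite mxE; rewrite -mulr_sumr e mulVf.
Qed.

Lemma polytopal_bigcup d (I : choiceType) (D : set I) (A : I -> set 'rV[R]_n) :
  finite_set D -> (forall k, D k -> polytopal d (A k)) ->
  polytopal d (\bigcup_(k in D) A k).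
Proof.
move=> finD HA.
(* The implication inside the existential makes the choice total, with the default [set0] outside
   [D]. *)
have /choice[G HG] : forall k, exists G : set 'M[R]_(d.+1, n), D k ->
    finite_set G /\ A k = \bigcup_(V in G) simplex V.
  move=> k; have [/HA[G HG]|nDk] := pselect (D k); first by exists G.
  by exists set0.
exists (\bigcup_(k in D) G k); split.
  by apply: bigcup_finite => // k /HG[].
rewrite bigcup_bigcup; apply: eq_bigcupr => k Dk.
by have [_ ->] := HG k Dk.
Qed.

(* The weights of a point of a simplex are parametrized as squares of the
   coordinates of a point of the unit sphere, so that the semianalytic set
   projecting onto [A] is given by polynomial equations only. *)
Lemma polytopal_subanalytic d A : compact A -> polytopal d A -> subanalytic A.
Proof.
move=> cA [D [finD defA]] a; exists setT; first exact: filterT.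
pose sq (b : 'rV[R]_(n + d.+1)) : 'rV[R]_d.+1 :=
  \row_l (b 0 (rshift n l)) ^+ 2.
pose B := [set b : 'rV[R]_(n + d.+1) |
  exists2 V, D V & lsubmx b = sq b *m V /\ \sum_l sq b 0 l = 1].
have BA b : B b -> A (lsubmx b).
  move=> [V DV [bV b1]]; rewrite defA; exists V => //; exists (sq b); split=> //.
  by move=> l; rewrite mxE sqr_ge0.
exists d.+1, B; split.
- have /finite_seqP[s Ds] := finD.
  move=> c; exists setT; split=> //; first exact: openT.
  (* For each simplex: [n] equations placing the point at the weighted sum of the vertices, and one
     equation for the unit sphere. *)
  pose f (i : 'I_(size s)) (j : 'I_(n + 1)) (b : 'rV[R]_(n + d.+1)) : R :=
    match fintype.split j with
    | inl r => b 0 (lshift d.+1 r) +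
        \sum_l (- s`_i l r) * (b 0 (rshift n l)) ^+ 2
    | inr _ => -1 + \sum_l 1 * (b 0 (rshift n l)) ^+ 2
    end.
  exists (size s), (n + 1)%N, f, (fun _ _ => true); split.
    move=> i j c' _; rewrite /f; case: fintype.split => [r|_].
      apply: analytic_at_add; first exact: analytic_at_coord.
      by apply: analytic_at_sum => l; exact: analytic_at_coord_sq.
    apply: analytic_at_add; first exact: analytic_at_cst.
    by apply: analytic_at_sum => l; exact: analytic_at_coord_sq.
  rewrite setIT setTI; apply/seteqP; split=> b.
    move=> [V DV [bV b1]]; have sV : V \in s by move: DV; rewrite Ds.
    have iV : (index V s < size s)%N by rewrite index_mem.
    exists (Ordinal iV) => // j _ /=; rewrite /f; case: fintype.split => [r|_] /=.
      rewrite nth_index //; move/rowP: bV => /(_ r); rewrite !mxE => ->.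
      rewrite -big_split big1 //= => l _; rewrite !mxE; lra.
    under eq_bigr do rewrite mul1r.
    by rewrite -b1; under [X in - X]eq_bigr do rewrite mxE; rewrite addrC subrr.
  move=> [i _ Hi]; exists s`_i; first by rewrite Ds /= mem_nth.
  split.
    apply/rowP=> r; have := Hi (lshift 1 r) I; rewrite /f /=.
    case: splitP => [r' /= rr'|k /=]; last by have := ltn_ord r; lia.
    have -> : r' = r by exact: val_inj.
    move=> /eqP; rewrite addr_eq0 mxE => /eqP ->; rewrite mxE -sumrN.
    by apply: eq_bigr => l _; rewrite !mxE; lra.
  have := Hi (rshift n ord0) I; rewrite /f /=.
  case: splitP => [r' /=|k _]; first by have := ltn_ord r'; lia.
  move=> /eqP; rewrite addrC subr_eq0 => /eqP <-.
  by apply: eq_bigr => l _; rewrite mxE mul1r.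
(* [B] lies in a product of compact sets: the coordinate projections of [A], and [[-1, 1]] for each
   sphere coordinate. *)
- pose C (i : 'I_(n + d.+1)) : set R := match fintype.split i with
    | inl r => (fun y : 'rV[R]_n => y 0 r) @` A
    | inr _ => `[-1, 1]%classic
    end.
  apply: (@precompact_subset _ _ [set b : 'rV[R]_(n + d.+1) |
      forall i, C i (b ord0 i)]).
    move=> b Bb i; rewrite /C; case: splitP => [r ir|l il].
      exists (lsubmx b); first exact: BA.
      by rewrite mxE; congr (b 0 _); exact: val_inj.
    have -> : i = rshift n l by exact: val_inj.
    have [V DV [_ b1]] := Bb.
    rewrite /= in_itv /= -ler_norml -(ler_pXn2r (n := 2)) ?nnegrE //.
    rewrite expr1n real_normK ?num_real // -b1 (bigD1 l) //= mxE lerDl.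
    by apply: sumr_ge0 => k _; rewrite mxE sqr_ge0.
  apply: compact_precompact; first exact: norm_hausdorff.
  apply: rV_compact => i; rewrite /C; case: fintype.split => [r|_].
    apply: continuous_compact => //; apply: continuous_subspaceT.
    exact: coord_continuous.
  exact: segment_compact.
- rewrite setIT; apply/seteqP; split=> [y|_ [b Bb <-]]; last exact: BA.
  rewrite {1}defA => -[V DV [w [w0 w1 ->]]].
  (* Square roots of the weights lift a point of [A] to [B]. *)
  pose r : 'rV[R]_d.+1 := \row_l Num.sqrt (w 0 l).
  have sqE : sq (row_mx (w *m V) r) = w.
    by apply/rowP=> l; rewrite mxE row_mxEr mxE sqr_sqrtr.
  exists (row_mx (w *m V) r); last by rewrite row_mxKl.
  by exists V => //; rewrite sqE row_mxKl.
Qed.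

End Polytopal.

Theorem proposition4p4 (R : realType) (n : nat) (F : based_sequence R n)
    (x : basis_index F -> 'rV[R]_n) :
  [/\ forall i, S_set x i = cone_formula x (S_set x) i,
      forall T : basis_index F -> set 'rV[R]_n,
        (forall i, T i = cone_formula x T i) -> forall i, T i = S_set x i,
      forall i, [/\ contractible R (S_set x i), compact (S_set x i)
                  & subanalytic (S_set x i)]
    & forall i j m, exponents j i m -> translate (S_set x j) m `<=` S_set x i].
Proof.
have compS i : compact (S_set x i).
  have [|d y A m _|_|_ cS] := S_set_ind R n F x (fun=> compact).
  - by move=> _ y; exact: compact_set1.
  - by move=> cA; apply: cone_compact; exact: translate_compact.
  - exact: bigcup_compact.
  - exact: cS.
(* Here the induction index matters: each cone adds one vertex, and unions need equal vertex
   counts. *)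
have [d polyS] : exists d, forall i, polytopal R n d (S_set x i).
  apply: S_set_ind.
  - exact: polytopal1.
  - exact: polytopal_cone.
  - exact: polytopal_bigcup.
split.
- exact: S_set_cone_formula.
- move=> T fT; apply: cone_formula_unique => //; exact: S_set_cone_formula.
- move=> i; split => //.
    apply: (star_contractible _ _ (x i)); first exact: apex_in_S_set.
    by move=> y t; exact: S_set_star.
  exact: polytopal_subanalytic (polyS i).
- exact: translate_S_set.
Qed.
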